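(* Assume the power injection $p$ satisfies: each $p_i$ is piece-wise continuous and there exists $0\leqslant\bar t<\infty$ with $p_i(t)=p_i^*$ for all $i\in\mathcal{I}$ and $t\geqslant\bar t$, where $\sum_{i\in\mathcal{I}}p_i^*=0$. Assume $\epsilon_iT_i<1$ for every $i\in\mathcal{I}_u$. Then the closed-loop system described in the context (network dynamics with $\alpha=\alpha_{DF}+\alpha_{MPC}$) satisfies: (i) (frequency invariance) for every $i\in\mathcal{I}_\omega$, if $\omega_i(0)\in[\underline\omega_i,\bar\omega_i]$ then $\omega_i(t)\in[\underline\omega_i,\bar\omega_i]$ for all $t\geqslant0$; (ii) (frequency attractivity) for every $i\in\mathcal{I}_\omega$, if $\omega_i(0)\notin[\underline\omega_i,\bar\omega_i]$ then there exists a finite $t_0$ with $\omega_i(t)\in[\underline\omega_i,\bar\omega_i]$ for all $t\geqslant t_0$; (iii) (asymptotic stability) the closed-loop trajectory converges to the same equilibrium $(f_\infty,\mathbf{0}_n)$ as the open-loop system ($\alpha\equiv\mathbf{0}_n$). Furthermore, $\alpha(t)$, $\alpha_{MPC}(t)$ and $\alpha_{DF}(t)$ converge to $\mathbf{0}_n$ as $t\to\infty$.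
   Context: Network: $\mathcal{G}=(\mathcal{I},\mathcal{E})$ connected undirected graph, $\mathcal{I}=\{1,\dots,n\}$, $\mathcal{E}=\{e_1,\dots,e_m\}$, fixed orientation, incidence matrix $D\in\mathbb{R}^{m\times n}$; $M=\mathrm{diag}(M_i)$, $E=\mathrm{diag}(E_i)$ with $M_i,E_i>0$; $Y_b\in\mathbb{R}^{m\times m}$ diagonal positive. $\mathcal{I}_\omega\subseteq\mathcal{I}_u\subseteq\mathcal{I}$; $\mathbb{A}=\{y\in\mathbb{R}^n:y_w=0\ \forall w\notin\mathcal{I}_u\}$. Dynamics: $\dot f=Y_bD\omega$, $M\dot\omega=-E\omega-D^Tf+p(t)+\alpha(t)$. Under the assumption on $p$, the open-loop system ($\alpha\equiv0$) converges to an equilibrium $(f_\infty,\mathbf{0}_n)$ determined by the power injection profile and network parameters. Bottom layer (MPC): parameters $T,\tilde t>0$, $N=\lceil\tilde t/T\rceil$, $c_i,\epsilon_i,T_i>0$ ($i\in\mathcal{I}_u$), $d>0$, safe bounds $\underline\omega_i<\bar\omega_i$ ($i\in\mathcal{I}_\omega$). For $\hat P=[\hat p(0),\dots,\hat p(N-1)]$, $f_0,\omega_0$, $a_0\in\mathbb{A}$, $\hat u^*(\hat P,f_0,\omega_0,a_0)$ is the $\hat u$-part of the unique optimal solution of: minimize $\sum_{i\in\mathcal{I}_u}c_i\hat u_i^2+d\beta^2$ over $\hat f(k),\hat\omega(k),\hat\alpha(k)$ ($k=0..N$), $\hat u\in\mathbb{R}^n$, $\beta\in\mathbb{R}$, s.t.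 for $k=0..N-1$: $\hat f(k+1)=\hat f(k)+TY_bD\hat\omega(k)$; $M\hat\omega(k+1)=M\hat\omega(k)+T(-E\hat\omega(k)-D^T\hat f(k)+\hat p(k)+\hat u)$; $\hat\alpha_i(k+1)=\hat\alpha_i(k)+T(-\hat\alpha_i(k)/T_i-\hat\omega_i(k)+\hat u_i)$ ($i\in\mathcal{I}_u$); $\hat\alpha_i\equiv0$ ($i\notin\mathcal{I}_u$); $\hat u\in\mathbb{A}$; $(\hat f(0),\hat\omega(0),\hat\alpha(0))=(f_0,\omega_0,a_0)$; $\underline\omega_i-\beta\leqslant\hat\omega_i(k+1)\leqslant\bar\omega_i+\beta$ ($i\in\mathcal{I}_\omega$); $|\hat u_i|\leqslant\epsilon_i|a_{0,i}|$ ($i\in\mathcal{I}_u$). Sampling times $0=\Delta^0<\Delta^1<\cdots$; piece-wise continuous forecasts $p^{fcst}_{\Delta^j}:[\Delta^j,\Delta^j+\tilde t]\to\mathbb{R}^n$, $\hat P^{fcst}_j=[p^{fcst}_{\Delta^j}(\Delta^j+kT)]_{k=0}^{N-1}$. Then $u_{MPC}(t)=\hat u^*(\hat P^{fcst}_j,f(\Delta^j),\omega(\Delta^j),\alpha_{MPC}(\Delta^j))$ for $t\in[\Delta^j,\Delta^{j+1})$; stability filter $\hat u_{MPC,i}(t)=\max\{-\epsilon_i|\alpha_{MPC,i}(t)|,\min\{\epsilon_i|\alpha_{MPC,i}(t)|,u_{MPC,i}(t)\}\}$; low-pass filter $\dot\alpha_{MPC,i}=-\alpha_{MPC,i}/T_i-\omega_i+\hat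 u_{MPC,i}$ for $i\in\mathcal{I}_u$, $\alpha_{MPC,i}\equiv0$ otherwise. Top layer: for $i\in\mathcal{I}_\omega$ let $\bar\gamma_i,\underline\gamma_i>0$ and $\underline\omega_i<\underline\omega_i^{thr}<0<\bar\omega_i^{thr}<\bar\omega_i$; let $v_i=E_i\omega_i+[D^T]_if-p_i-\alpha_{MPC,i}$ (where $[D^T]_i$ is the $i$th row of $D^T$), and $\alpha_{DF,i}=\min\{0,\bar\gamma_i(\bar\omega_i-\omega_i)/(\omega_i-\bar\omega_i^{thr})+v_i\}$ if $\omega_i>\bar\omega_i^{thr}$, $\alpha_{DF,i}=0$ if $\underline\omega_i^{thr}\leqslant\omega_i\leqslant\bar\omega_i^{thr}$, $\alpha_{DF,i}=\max\{0,\underline\gamma_i(\underline\omega_i-\omega_i)/(\underline\omega_i^{thr}-\omega_i)+v_i\}$ if $\omega_i<\underline\omega_i^{thr}$; $\alpha_{DF,i}\equiv0$ for $i\notin\mathcal{I}_\omega$. The total control is $\alpha=\alpha_{DF}+\alpha_{MPC}$. *)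

(* Defs.v *)
From mathcomp Require Import all_boot all_order all_algebra.
From mathcomp Require Import all_classical all_reals all_analysis.
Import Order.TTheory GRing.Theory Num.Theory numFieldNormedType.Exports.

Set Implicit Arguments.
Unset Strict Implicit.
Unset Printing Implicit Defensive.

Local Open Scope ring_scope.
Local Open Scope classical_set_scope.

Definition adj n m (src tgt : 'I_m -> 'I_n) : rel 'I_n :=
  fun i j => [exists e, ((src e == i) && (tgt e == j)) || ((src e == j) && (tgt e == i))].

Definition simple_connected_graph n m (src tgt : 'I_m -> 'I_n) : Prop :=
  (forall e, src e != tgt e) /\
  (forall e e', (src e == src e') && (tgt e == tgt e') ||
                (src e == tgt e') && (tgt e == src e') -> e = e') /\
  (forall i j, connect (adj src tgt) i j).

Definition incidence (R : pzRingType) n m (src tgt : 'I_m -> 'I_n) : 'M[R]_(m, n) :=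
  \matrix_(e < m, i < n) ((i == src e)%:R - (i == tgt e)%:R).

Definition diagv (R : pzRingType) k (x : 'I_k -> R) : 'M[R]_k := diag_mx (\row_i x i).

Definition pwc_on (R : realType) (a b : R) (g : R -> R) : Prop :=
  exists s : seq R,
    {within [set x | a <= x <= b /\ x \notin s], continuous g} /\
    (forall x, a < x <= b -> exists l : R, g y @[y --> x^'-] --> l) /\
    (forall x, a <= x < b -> exists l : R, g y @[y --> x^'+] --> l).

(* Solutions of ODEs (Caratheodory sense, on [0, +oo)):
   x(t) = x(0) + \int_0^t g(s) ds for all t >= 0 (Lebesgue integral). *)
Definition ode_sol (R : realType) (x g : R -> R) : Prop :=
  forall t : R, 0 <= t ->
    lebesgue_measure.-integrable `[0%R, t] (EFin \o g) /\
    (((x t - x 0)%R)%:E = \int[lebesgue_measure]_(s in `[0%R, t]) (g s)%:E)%E.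

Definition vode_sol (R : realType) k (x g : R -> 'cV[R]_k) : Prop :=
  forall i : 'I_k, ode_sol (fun t => x t i 0) (fun t => g t i 0).

Definition horizon (R : realType) (T tt : R) : nat := `|Num.ceil (tt / T)|%N.

(* constraints of the MPC problem; decision variables
   fh(k), wh(k), ah(k) (k = 0..N), u, beta *)
Definition mpc_feasible (R : realType) n m (Iu Iw : {set 'I_n})
  (D : 'M[R]_(m, n)) (M E : 'M[R]_n) (Yb : 'M[R]_m) (T : R) (N : nat)
  (Ti eps wlo whi : 'I_n -> R)
  (P : nat -> 'cV[R]_n) (f0 : 'cV[R]_m) (w0 a0 : 'cV[R]_n)
  (fh : nat -> 'cV[R]_m) (wh ah : nat -> 'cV[R]_n) (u : 'cV[R]_n) (beta : R) : Prop :=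
  (forall k, (k < N)%N -> fh k.+1 = fh k + T *: (Yb *m D *m wh k)) /\
  (forall k, (k < N)%N ->
     M *m wh k.+1 = M *m wh k + T *: (- (E *m wh k) - D^T *m fh k + P k + u)) /\
  (forall k i, (k < N)%N -> i \in Iu ->
     ah k.+1 i 0 = ah k i 0 + T * (- (ah k i 0 / Ti i) - wh k i 0 + u i 0)) /\
  (forall k i, (k <= N)%N -> i \notin Iu -> ah k i 0 = 0) /\
  (forall i, i \notin Iu -> u i 0 = 0) /\
  (fh 0%N = f0 /\ wh 0%N = w0 /\ ah 0%N = a0) /\
  (forall k i, (k < N)%N -> i \in Iw ->
     wlo i - beta <= wh k.+1 i 0 <= whi i + beta) /\
  (forall i, i \in Iu -> `|u i 0| <= eps i * `|a0 i 0|).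

Definition mpc_cost (R : realType) n (Iu : {set 'I_n}) (c : 'I_n -> R) (d : R)
  (u : 'cV[R]_n) (beta : R) : R :=
  \sum_(i in Iu) c i * (u i 0) ^+ 2 + d * beta ^+ 2.

(* u is the u-part of an optimal solution of the MPC problem
   (the optimal solution being unique, this characterises u^*(P,f0,w0,a0)) *)
Definition mpc_opt (R : realType) n m (Iu Iw : {set 'I_n})
  (D : 'M[R]_(m, n)) (M E : 'M[R]_n) (Yb : 'M[R]_m) (T : R) (N : nat)
  (Ti eps wlo whi c : 'I_n -> R) (d : R)
  (P : nat -> 'cV[R]_n) (f0 : 'cV[R]_m) (w0 a0 : 'cV[R]_n) (u : 'cV[R]_n) : Prop :=
  exists fh wh ah beta,
    mpc_feasible Iu Iw D M E Yb T N Ti eps wlo whi P f0 w0 a0 fh wh ah u beta /\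
    forall fh' wh' ah' u' beta',
      mpc_feasible Iu Iw D M E Yb T N Ti eps wlo whi P f0 w0 a0 fh' wh' ah' u' beta' ->
      mpc_cost Iu c d u beta <= mpc_cost Iu c d u' beta'.

Definition stab_filter (R : realType) (eps a u : R) : R :=
  Num.max (- (eps * `|a|)) (Num.min (eps * `|a|) u).

Definition alpha_DF_i (R : realType) (gup glo whi wlo whi_thr wlo_thr w v : R) : R :=
  if whi_thr < w then Num.min 0 (gup * (whi - w) / (w - whi_thr) + v)
  else if w < wlo_thr then Num.max 0 (glo * (wlo - w) / (wlo_thr - w) + v)
  else 0.

Definition alpha_DF (R : realType) n m (Iw : {set 'I_n}) (D : 'M[R]_(m, n))
  (Ev gup glo whi wlo whi_thr wlo_thr : 'I_n -> R)
  (f : 'cV[R]_m) (w aM p : 'cV[R]_n) : 'cV[R]_n :=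
  \col_i (if i \in Iw then
            alpha_DF_i (gup i) (glo i) (whi i) (wlo i) (whi_thr i) (wlo_thr i) (w i 0)
              (Ev i * w i 0 + (D^T *m f) i 0 - p i 0 - aM i 0)
          else 0).

(* Main.v *)
(* Once p has settled at p*, the energy
     sum_e (f - finf)_e^2 / y_e + sum_i M_i w_i^2 + sum_i alphaM_i^2
   decreases at rate at least 2 (sum_i E_i w_i^2 + sum_i (1/T_i - eps_i) alphaM_i^2): the
   stability filter enforces |u_i| <= eps_i |alphaM_i|, and w_i alphaDF_i <= 0 by the sign
   conditions on the thresholds.  Hence the state is bounded and Lipschitz in time, so w and
   alphaM vanish at infinity, and alphaDF is zero as soon as w lies between the thresholds.
   Then D^T (f - finf) vanishes too, because M w cannot stay small under a persistent
   forcing, and D^T is injective on the range of Yb D, to which f - finf belongs.  The open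
   loop is the case alphaM = alphaDF = 0.  Invariance holds because w_i' <= 0 whenever
   w_i exceeds its upper bound (and symmetrically below). *)
Require Import Defs.
From mathcomp Require Import all_boot all_order all_algebra.
From mathcomp Require Import all_classical all_reals all_analysis.
From mathcomp Require Import ring lra.
Import Order.TTheory GRing.Theory Num.Theory numFieldNormedType.Exports.
Local Open Scope ring_scope.
Local Open Scope classical_set_scope.

Set Implicit Arguments.
Unset Strict Implicit.
Unset Printing Implicit Defensive.

(** * Calculus of integral solutions of differential equations *)

Section OdeSol.
Context {R : realType}.
Implicit Types (x g : R -> R) (s t k : R).
Local Notation mu := (@lebesgue_measure R).

Lemma ode_sol_cst k : ode_sol (fun=> k) (fun=> 0).
Proof.
move=> t t0; split; first exact: (@integrable0 _ _ _ mu).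
by rewrite subrr integral0.
Qed.

Lemma eq_ode_sol x g x' g' : (forall t, 0 <= t -> x t = x' t) ->
  (forall t, 0 <= t -> g t = g' t) -> ode_sol x g -> ode_sol x' g'.
Proof.
move=> xx' gg' xg t t0; have [ig e] := xg t t0.
have gg't : {in `[0, t], EFin \o g =1 EFin \o g'}.
  by move=> r; rewrite inE/= in_itv/= => /andP[r0 _]; rewrite gg'.
split; first by apply: (@eq_integrable _ _ _ mu) gg't ig.
rewrite -!xx'// e; apply: eq_integral => r rt.
exact: gg't.
Qed.

Lemma ode_solZ k x g : ode_sol x g -> ode_sol (fun t => k * x t) (fun t => k * g t).
Proof.
move=> xg t t0; have [ig e] := xg t t0; split.
  by apply: (integrableZl _ k ig).
under eq_integral do rewrite EFinM.
by rewrite integralZl// -e -EFinM mulrBr.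
Qed.

Lemma ode_solD x g x' g' : ode_sol x g -> ode_sol x' g' ->
  ode_sol (fun t => x t + x' t) (fun t => g t + g' t).
Proof.
move=> xg xg' t t0; have [ig e] := xg t t0; have [ig' e'] := xg' t t0; split.
  by apply: (integrableD _ ig ig').
under eq_integral do rewrite EFinD.
by rewrite integralD// -e -e' -EFinD; congr EFin; ring.
Qed.

Lemma ode_sol_sum (J : Type) (r : seq J) (x g : J -> R -> R) :
  (forall j, ode_sol (x j) (g j)) ->
  ode_sol (fun t => \sum_(j <- r) x j t) (fun t => \sum_(j <- r) g j t).
Proof.
move=> xg; elim: r => [|j r IH].
  by apply: eq_ode_sol (ode_sol_cst 0) => t _; rewrite big_nil.
by apply: eq_ode_sol (ode_solD (xg j) IH) => t _; rewrite big_cons.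
Qed.

Lemma vode_sol_mulmx p q (A : 'M[R]_(q, p)) (x g : R -> 'cV[R]_p) :
  vode_sol x g -> vode_sol (fun t => A *m x t) (fun t => A *m g t).
Proof.
move=> xg i.
have H := ode_sol_sum (index_enum 'I_p) (fun j => ode_solZ (A i j) (xg j)).
by apply: eq_ode_sol H => t _; rewrite mxE.
Qed.

Lemma ode_sol_Rintegral x g t : ode_sol x g -> 0 <= t ->
  x t = x 0 + \int[mu]_(s in `[0, t]) g s.
Proof. by move=> xg t0; rewrite /Rintegral -(xg t t0).2 /= addrC subrK. Qed.

(** The increment is the integral of [g] over []s, t]], so nothing is asked of [g] at [s].
    Invariance relies on this: the rate has no known sign at the last time spent below the bound. *)
Lemma ode_sol_le x g s t k : ode_sol x g -> 0 <= s -> s <= t ->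
  (forall r, s < r -> r <= t -> g r <= k) -> x t - x s <= k * (t - s).
Proof.
move=> xg s0 st gk; have t0 := le_trans s0 st.
rewrite (ode_sol_Rintegral xg t0) (ode_sol_Rintegral xg s0).
rewrite opprD addrACA subrr add0r Rintegral_itvB ?bnd_simp//; last exact: (xg t t0).1.
have -> : k * (t - s) = \int[mu]_(r in `]s, t]) k.
  rewrite Rintegral_cst//= lebesgue_measure_itv/= lte_fin.
  have [//|ts] := ltP s t.
  by rewrite (_ : t = s) ?subrr ?mulr0//; apply/eqP; rewrite eq_le ts st.
apply: le_Rintegral => //.
- apply: (integrableS _ _ _ (xg t t0).1) => //.
  by apply: subset_itvr; rewrite bnd_simp.
- apply/integrableP; split; first exact: measurable_cst.
  rewrite integral_cst//= lebesgue_measure_itv/=.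
  by case: ifP => _; rewrite -?EFinM ?mule0 ltry.
- by move=> r /=; rewrite in_itv/= => /andP[]; exact: gk.
Qed.

Lemma ode_sol_norm_le x g s t k : ode_sol x g -> 0 <= s -> s <= t ->
  (forall r, s < r -> r <= t -> `|g r| <= k) -> `|x t - x s| <= k * (t - s).
Proof.
move=> xg s0 st gk; rewrite ler_norml; apply/andP; split; last first.
  by apply: (ode_sol_le xg) => // r sr rt; exact/(le_trans (ler_norm _))/gk.
rewrite lerNl -mulN1r mulrBr.
apply: (ode_sol_le (ode_solZ (-1) xg)) => // r sr rt.
by rewrite mulN1r (le_trans (ler_norm _))// normrN gk.
Qed.

Lemma ode_sol_continuous x g t : ode_sol x g -> 0 <= t -> {within `[0, t], continuous x}.
Proof.
move=> xg t0.
have /subspace_eq_continuous : {in `[0, t],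
    (fun s => x 0 + \int[mu]_(r in `[0, s]) g r) =1 x}.
  move=> s; rewrite inE/= in_itv/= => /andP[s0 _].
  by rewrite -(ode_sol_Rintegral xg s0).
apply.
move=> s; apply: cvgD; first exact: cvg_cst.
exact: (parameterized_integral_continuous t0 (xg t t0).1).
Qed.

(** The integral of [|g|] over [[0, t]] bounds the total variation. This local bound is what makes
    the rates bounded before any uniform bound is available. *)
Lemma ode_sol_bounded x g t : ode_sol x g -> 0 <= t ->
  exists B, forall s, 0 <= s <= t -> `|x s| <= B.
Proof.
move=> xg t0; have [ig _] := xg t t0.
exists (`|x 0| + \int[mu]_(r in `[0, t]) `|g r|) => s /andP[s0 st].
rewrite (ode_sol_Rintegral xg s0) (le_trans (ler_normD _ _))// lerD2l.
apply: le_trans (le_normr_Rintegral _ (xg s s0).1) _ => //.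
have ia : mu.-integrable `[0, t] (EFin \o (fun r => `|g r|)).
  by have := integrable_norm ig.
rewrite -subr_ge0 Rintegral_itvB ?bnd_simp//.
exact: Rintegral_ge0.
Qed.

End OdeSol.

(* Lets differential inequalities for squares of absolutely continuous functions be proved
   by subdividing [a, b], without differentiating almost everywhere. *)
Lemma quadratic_increment (R : realType) (F : R -> R) (a b k C : R) : a <= b ->
  (forall s t, a <= s -> s <= t -> t <= b -> F t - F s <= k * (t - s) + C * (t - s) ^+ 2) ->
  F b - F a <= k * (b - a).
Proof.
move=> ab FC; set l := b - a; have l0 : 0 <= l by rewrite subr_ge0.
have FN (N : nat) : F b - F a <= k * l + C * l ^+ 2 / N.+1%:R.
  set h := l / N.+1%:R.
  have h0 : 0 <= h by rewrite divr_ge0.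
  have hl : h * N.+1%:R = l by rewrite divfK.
  have step (i : nat) : (i <= N.+1)%N ->
      F (a + h * i%:R) - F a <= (k * h + C * h ^+ 2) * i%:R.
    elim: i => [_|i IH iN]; first by rewrite !mulr0 addr0 subrr.
    have := FC (a + h * i%:R) (a + h * i.+1%:R).
    rewrite lerDl lerD2l mulr_ge0// ler_wpM2l ?ler_nat// => /(_ isT isT).
    have -> : a + h * i.+1%:R <= b.
      by rewrite -lerBrDl -/l -hl ler_wpM2l// ler_nat.
    move=> /(_ isT); have := IH (ltnW iN).
    rewrite -natr1 mulrDr mulr1.
    have -> : a + (h * i%:R + h) - (a + h * i%:R) = h by ring.
    by lra.
  have := step N.+1 (leqnn _); rewrite hl (_ : a + l = b); last by rewrite /l; ring.
  move=> /le_trans; apply.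
  have -> // : (k * h + C * h ^+ 2) * N.+1%:R = k * l + C * l ^+ 2 / N.+1%:R.
  by rewrite -hl; field; rewrite nat1r pnatr_eq0.
apply/ler_addgt0Pr => e e0.
have [N CN] : exists N : nat, `|C * l ^+ 2 / e| < N%:R.
  by exists (Num.bound `|C * l ^+ 2 / e|); apply: archi_boundP.
apply: le_trans (FN N) _; rewrite lerD2l ler_pdivrMr// [leRHS]mulrC -ler_pdivrMr//.
apply: (le_trans (ler_norm _)); by rewrite (le_trans (ltW CN))// ler_nat.
Qed.

(** * Energy decay and convergence for dissipative systems *)

Section Dissipative.
Context {R : realType} (J : finType) (x g : J -> R -> R) (c : J -> R).
Hypotheses (xg : forall j, ode_sol (x j) (g j)) (c0 : forall j, 0 < c j).

Let V t := \sum_j c j * x j t ^+ 2.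

(** On a short interval, the difference of squares factors as [x j t + x j s] times the increment of
    [x j]. Freezing the first factor leaves a linear combination of solutions, and replacing it by
    [2 * x j r] costs at most [L * (t - s) * L]. This error is quadratic in [t - s], so
    [quadratic_increment] removes it. *)
Lemma energy_le (a b L q : R) : 0 <= a -> a <= b ->
  (forall t, a <= t <= b -> forall j, `|g j t| <= L) ->
  (forall t, a <= t <= b -> \sum_j c j * (x j t * g j t) <= q) ->
  V b - V a <= 2 * q * (b - a).
Proof.
move=> a0 ab gL gq.
apply: (@quadratic_increment _ _ _ _ _ (\sum_j c j * L ^+ 2)) => // s t as_ st tb.
have s0 := le_trans a0 as_.
have lip j u v : s <= u -> u <= v -> v <= t -> `|x j v - x j u| <= L * (v - u).
  move=> su uv vt; apply: (ode_sol_norm_le (xg j)) => //; first exact: le_trans su.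
  move=> r ur rv; apply: gL.
  by rewrite (le_trans as_)/= ?(le_trans rv)// ?(le_trans vt)// (le_trans su)// ltW.
pose y j := c j * (x j t + x j s).
have -> : V t - V s = \sum_j y j * x j t - \sum_j y j * x j s.
  by rewrite -!sumrB; apply: eq_bigr => j _; rewrite /y; ring.
have -> : 2 * q * (t - s) + (\sum_j c j * L ^+ 2) * (t - s) ^+ 2 =
  (2 * q + \sum_j c j * L ^+ 2 * (t - s)) * (t - s).
  by rewrite -[\sum_j c j * L ^+ 2 * (t - s)]mulr_suml; ring.
have H := ode_sol_sum (index_enum J) (fun j => ode_solZ (y j) (xg j)).
apply: (ode_sol_le H) => // r sr rt.
have arb : a <= r <= b by rewrite (le_trans as_ (ltW sr)) (le_trans rt).
apply: (@le_trans _ _ (2 * \sum_j c j * (x j r * g j r) + \sum_j c j * L ^+ 2 * (t - s))).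
  rewrite mulr_sumr -big_split/=; apply: ler_sum => j _; rewrite /y.
  have -> : c j * (x j t + x j s) * g j r =
    c j * (2 * (x j r * g j r) + ((x j t - x j r) - (x j r - x j s)) * g j r) by ring.
  have -> : 2 * (c j * (x j r * g j r)) + c j * L ^+ 2 * (t - s) =
    c j * (2 * (x j r * g j r) + L * (t - s) * L) by ring.
  rewrite ler_pM2l// lerD2l.
  apply: le_trans (ler_norm _) _; rewrite normrM ler_pM ?gL//.
  apply: le_trans (ler_normB _ _) _.
  have := lip j r t (ltW sr) rt (lexx _); have := lip j s r (lexx _) (ltW sr) rt.
  by lra.
by rewrite lerD2r ler_pM2l// gq.
Qed.

Variables (k : J -> R) (t0 : R).
Hypotheses (t00 : 0 <= t0) (k0 : forall j, 0 <= k j).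
Hypothesis gbnd : forall B, exists L, forall t, t0 <= t ->
  (forall j, `|x j t| <= B) -> forall j, `|g j t| <= L.
Hypothesis diss : forall t, t0 <= t ->
  \sum_j c j * (x j t * g j t) <= - \sum_j k j * x j t ^+ 2.

Lemma dissipation_ge0 t : 0 <= \sum_j k j * x j t ^+ 2.
Proof. by apply: sumr_ge0 => j _; rewrite mulr_ge0 ?sqr_ge0. Qed.

(** On [[a, b]] the solution is bounded, so [gbnd] yields some Lipschitz constant; its size is
    irrelevant, since it does not occur in the conclusion of [energy_le]. *)
Lemma energy_nonincreasing a b : t0 <= a -> a <= b -> V b <= V a.
Proof.
move=> ta ab; rewrite -subr_le0.
have a0 := le_trans t00 ta; have b0 := le_trans a0 ab.
have /choice[B xB] := fun j => ode_sol_bounded (xg j) b0.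
have [L gL] := gbnd (\sum_j `|B j|).
have := @energy_le a b L 0 a0 ab; rewrite mulr0 mul0r; apply.
  move=> t /andP[at_ tb]; apply: gL; first exact: le_trans at_.
  move=> j; rewrite (bigD1 j)//= -[leLHS]addr0 lerD ?sumr_ge0//.
  by rewrite (le_trans _ (ler_norm _))// xB// tb (le_trans a0).
move=> t /andP[at_ _]; apply: le_trans (diss _) _; first exact: le_trans at_.
by rewrite oppr_le0 dissipation_ge0.
Qed.

Lemma energy_ge0 t : 0 <= V t.
Proof. by apply: sumr_ge0 => j _; rewrite mulr_ge0 ?sqr_ge0// ltW. Qed.

Lemma dissipative_bounded : exists2 B, 0 < B & forall t j, t0 <= t -> `|x j t| <= B.
Proof.
(* The energy bounds [x j t ^+ 2] by [V t0 / c j]; the inequality [|y| <= 1 + y ^+ 2] then avoids a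
   square root. *)
pose b j := 1 + V t0 / c j.
have b0 j : 0 <= b j by rewrite addr_ge0// divr_ge0// ?energy_ge0// ltW.
exists (1 + \sum_j b j); first by rewrite ltr_wpDr// sumr_ge0.
move=> t j tt; apply: (@le_trans _ _ (b j)); last first.
  by rewrite (bigD1 j)//= addrCA lerDl addr_ge0// sumr_ge0.
have : x j t ^+ 2 <= V t0 / c j.
  rewrite ler_pdivlMr// mulrC; apply: le_trans (energy_nonincreasing (lexx _) tt).
  rewrite /V (bigD1 j)//= lerDl sumr_ge0// => i _.
  by rewrite mulr_ge0 ?sqr_ge0// ltW.
rewrite -real_normK ?num_real// /b.
by have := sqr_ge0 (`|x j t| - 1); nra.
Qed.

(** A Barbalat argument: if [|x j|] reached [e] at arbitrarily late times, the Lipschitz bound would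
    keep it above [e / 2] for a fixed duration after each of them. Each such episode costs a fixed
    amount of energy, which is impossible for a nonnegative nonincreasing energy. *)
Lemma dissipative_cvg0 j : 0 < k j -> x j t @[t --> +oo] --> 0.
Proof.
move=> kj; have [B B0 xB] := dissipative_bounded.
have [L' gL'] := gbnd B.
pose L := 1 + `|L'|; have L0 : 0 < L by rewrite ltr_pwDl.
have gL t i : t0 <= t -> `|g i t| <= L.
  move=> tt; apply: le_trans (gL' t tt (fun i => xB t i tt) i) _.
  by rewrite (le_trans (ler_norm _))// lerDr.
apply/cvgrPdist_lt => e e0; apply: contrapT.
move=> /not_near_inftyP N.
(* During [tau] the component moves by at most [e / 2], and [q] is the least dissipation rate while
   it stays above [e / 2]. *)
pose tau := e / (2 * L); have tau0 : 0 < tau by rewrite divr_gt0// mulr_gt0.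
pose q := k j * (e / 2) ^+ 2; have q0 : 0 < q by rewrite mulr_gt0// exprn_gt0// divr_gt0.
have drop t : t0 <= t -> exists2 t', t0 <= t' & V t' <= V t - 2 * q * tau.
  move=> tt; have [s ts /negP] := N t (num_real _).
  rewrite sub0r normrN -leNgt => xs.
  have s0 := le_trans tt (ltW ts); exists (s + tau).
    by rewrite (le_trans s0)// lerDl ltW.
  apply: le_trans (_ : V s - 2 * q * tau <= _); last first.
    by rewrite lerD2r energy_nonincreasing// ltW.
  rewrite -lerBlDl; have := @energy_le s (s + tau) L (- q).
  rewrite (addrC s) addrK mulrN mulNr; apply.
  - exact: le_trans s0.
  - by rewrite lerDr ltW.
  - by move=> r /andP[sr _] i; apply: gL; apply: le_trans sr.
  move=> r /andP[sr rs]; apply: le_trans (diss (le_trans s0 sr)) _.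
  rewrite lerN2 (bigD1 j)//= -[leLHS]addr0 lerD//; last first.
    by apply: sumr_ge0 => i _; rewrite mulr_ge0 ?sqr_ge0.
  rewrite ler_pM2l// -[leRHS]real_normK ?num_real// ler_sqr ?nnegrE//; last first.
    by rewrite divr_ge0// ltW.
  have : `|x j r - x j s| <= L * (r - s).
    apply: (ode_sol_norm_le (xg j)) => //; first exact: le_trans s0.
    by move=> u su _; apply: gL; apply: le_trans s0 (ltW su).
  have : L * (r - s) <= e / 2.
    apply: (@le_trans _ _ (L * tau)); first by rewrite ler_pM2l// lerBlDr.
    by rewrite le_eqVlt; apply/orP; left; apply/eqP; rewrite /tau; field; rewrite gt_eqF.
  have := ler_normD (x j s - x j r) (x j r); rewrite subrK distrC.
  by lra.
have iterdrop n : exists2 t, t0 <= t & V t <= V t0 - 2 * q * tau * n%:R.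
  elim: n => [|n [t tt Vt]]; first by exists t0; rewrite // mulr0 subr0.
  have [t' tt' Vt'] := drop t tt; exists t' => //.
  by rewrite -natr1; lra.
have d0 : 0 < 2 * q * tau by rewrite mulr_gt0// mulr_gt0.
have [n Vn] : exists n : nat, V t0 / (2 * q * tau) < n%:R.
  exists (Num.bound (V t0 / (2 * q * tau))); apply: archi_boundP.
  by rewrite divr_ge0 ?energy_ge0// ltW.
have [t _ Vt] := iterdrop n.
have := energy_ge0 t; rewrite ltr_pdivrMr// in Vn; lra.
Qed.

End Dissipative.

(** * Limits at infinity *)

Lemma near_pinfty_ge (R : realType) (P : set R) : (\forall t \near +oo, P t) ->
  \forall t \near +oo, forall s, t <= s -> P s.
Proof.
move=> [M [Mr MP]]; exists M; split=> // t Mt s ts.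
exact/MP/(lt_le_trans Mt ts).
Qed.

Lemma near_pinfty_gt (R : realType) (a : R) : \forall t \near +oo, a < t.
Proof. by exists a; split; rewrite ?num_real. Qed.

Lemma cvg_coord (R : realType) p q (T : Type) (F : set_system T) (FF : Filter F)
  (A : T -> 'M[R]_(p, q)) (B : 'M[R]_(p, q)) :
  (forall i j, A t i j @[t --> F] --> B i j) -> A t @[t --> F] --> B.
Proof.
move=> AB; apply/cvg_ballP => e e0.
have H : \forall t \near F, forall ij : 'I_p * 'I_q, ball (B ij.1 ij.2) e (A t ij.1 ij.2).
  by apply: filter_forall => -[i j]; exact: (cvg_ball (AB i j)).
by apply: filterS H => t H; split=> // i j; exact: (H (i, j)).
Qed.

Lemma cvg_mulmx0 (R : realType) p q (A : 'M[R]_(q, p)) (v : R -> 'cV[R]_p) :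
  (forall i, v t i 0 @[t --> +oo] --> 0) ->
  forall i, (A *m v t) i 0 @[t --> +oo] --> 0.
Proof.
move=> v0 i; under eq_fun do rewrite mxE.
elim: (index_enum 'I_p) => [|j r IH].
  under eq_fun do rewrite big_nil; exact: cvg_cst.
under eq_fun do rewrite big_cons.
have := cvgD (cvgM (cvg_cst (A i j)) (v0 j)) IH.
by rewrite mulr0 addr0; apply.
Qed.

Lemma norm_mulmx_le (R : realType) p q (A : 'M[R]_(q, p)) (v : 'cV[R]_p) (B : R) :
  (forall j, `|v j 0| <= B) -> forall i, `|(A *m v) i 0| <= (\sum_j `|A i j|) * B.
Proof.
move=> vB i; rewrite mxE mulr_suml (le_trans (ler_norm_sum _ _ _))// ler_sum// => j _.
by rewrite normrM ler_wpM2l.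
Qed.

(* If [q] stayed away from 0, then, varying slowly, it would move [y] by about [- q t] over
   the time interval [t, t + 1]. *)
Lemma ode_sol_forcing_cvg0 (R : realType) (y h q r : R -> R) :
  ode_sol y h -> ode_sol q r -> y t @[t --> +oo] --> 0 -> r t @[t --> +oo] --> 0 ->
  h t + q t @[t --> +oo] --> 0 -> q t @[t --> +oo] --> 0.
Proof.
move=> yh qr /cvgrPdist_lt y0 /cvgrPdist_lt r0 /cvgrPdist_lt hq0.
apply/cvgrPdist_lt => e e0; have e50 : 0 < e / 5 by rewrite divr_gt0.
have Hs : \forall s \near +oo, [/\ `|y s| < e / 5, `|r s| < e / 5 & `|h s + q s| < e / 5].
  near=> s; split; rewrite -normrN -sub0r; near: s.
  - exact: y0.
  - exact: r0.
  - exact: hq0.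
have Ht := near_pinfty_ge Hs.
near=> t.
have H s : t <= s -> [/\ `|y s| < e / 5, `|r s| < e / 5 & `|h s + q s| < e / 5].
  by move: s; near: t.
have t0 : 0 <= t by apply: ltW; near: t; exact: near_pinfty_gt.
have t1 : t <= t + 1 by rewrite lerDl.
have qt s : t < s -> s <= t + 1 -> `|q s - q t| <= e / 5.
  move=> ts st; have : `|q s - q t| <= e / 5 * (s - t).
    by apply: (ode_sol_norm_le qr) => // [|u tu _]; [exact: ltW|have [_ /ltW] := H u (ltW tu)].
  by move/le_trans; apply; rewrite ler_piMr ?lerBlDl// ltW.
(* Four errors of size [e / 5] add up in the bound on [q t]: two values of [y], the drift of [q],
   and [h + q]. *)
have up : y (t + 1) - y t <= (e / 5 + e / 5 - q t) * (t + 1 - t).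
  apply: (ode_sol_le yh) => // s ts st; have [_ _] := H s (ltW ts).
  have := qt s ts st; rewrite ler_norml ltr_norml => /andP[q1 q2] /andP[h1 h2].
  clear -q1 q2 h1 h2; lra.
have dn : - 1 * y (t + 1) - - 1 * y t <= (e / 5 + e / 5 + q t) * (t + 1 - t).
  apply: (ode_sol_le (ode_solZ (- 1) yh)) => // s ts st; have [_ _] := H s (ltW ts).
  have := qt s ts st; rewrite ler_norml ltr_norml => /andP[q1 q2] /andP[h1 h2].
  clear -q1 q2 h1 h2; lra.
have [+ _ _] := H _ t1; have [+ _ _] := H _ (lexx t).
move: up dn; rewrite (addrC t) addrK !mulr1 sub0r normrN !ltr_norml.
move=> up dn /andP[y1 y2] /andP[y3 y4]; clear -up dn y1 y2 y3 y4; lra.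
Unshelve. all: by end_near.
Qed.

(** * The weighted graph Laplacian *)

Section Laplacian.
Context {R : realType} {n m : nat}.
Variables (yv : 'I_m -> R) (yv_gt0 : forall e, 0 < yv e).

(** The diagonal entries of [K^T *m L *m K], with [L] the Laplacian, are sums of the nonnegative
    terms [yv e * (D *m K) e j ^+ 2], so each term vanishes. *)
Lemma laplacian_ker p (D : 'M[R]_(m, n)) (K : 'M[R]_(n, p)) :
  D^T *m (diagv yv *m D) *m K = 0 -> D *m K = 0.
Proof.
move=> LK; apply/matrixP => e j; rewrite [RHS]mxE.
have : (K^T *m (D^T *m (diagv yv *m D) *m K)) j j = 0 by rewrite LK mulmx0 mxE.
have -> : K^T *m (D^T *m (diagv yv *m D) *m K) = (D *m K)^T *m (diagv yv *m (D *m K)).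
  by rewrite trmx_mul !mulmxA.
rewrite mxE /diagv mul_diag_mx => /eqP; rewrite psumr_eq0.
  move=> /allP/(_ e (mem_index_enum _)); rewrite !mxE/= mulrCA mulf_eq0.
  by rewrite gt_eqF//= mulf_eq0 orbb => /eqP.
move=> i _; rewrite !mxE mulrCA mulr_ge0 ?(ltW (yv_gt0 _))//.
by rewrite -expr2 sqr_ge0.
Qed.

(** By [laplacian_ker] the kernel of the Laplacian lies in that of [D], so the row spaces are
    included the other way round. The matrix [B] is a left inverse of [D^T] on the range of
    [diagv yv *m D], and recovers flows from nodal imbalances. *)
Lemma laplacian_factor (D : 'M[R]_(m, n)) :
  exists B, diagv yv *m D = B *m (D^T *m (diagv yv *m D)).
Proof.
apply/submxP; rewrite submxE -mulmxA.
by rewrite (laplacian_ker (mulmx_coker _)) mulmx0.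
Qed.

(** Fredholm alternative for a symmetric matrix: by connectedness the kernel consists of constant
    vectors, to which a vector of zero sum is orthogonal. *)
Lemma laplacian_solve (src tgt : 'I_m -> 'I_n) (q : 'cV[R]_n) :
  simple_connected_graph src tgt -> \sum_i q i 0 = 0 ->
  let D := incidence R src tgt in
  exists z, D^T *m (diagv yv *m D *m z) = q.
Proof.
move=> [_ [_ conn]] q0 D; set L := D^T *m (diagv yv *m D).
suff /submxP[X qX] : (q^T <= L)%MS.
  exists X^T; rewrite -[RHS]trmxK qX trmx_mul.
  by rewrite /L !trmx_mul trmxK /diagv tr_diag_mx !mulmxA.
rewrite submxE; set K := cokermx L.
have DK : D *m K = 0 by exact/laplacian_ker/mulmx_coker.
have adjK j i i' : adj src tgt i i' -> K i j = K i' j.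
  move=> /existsP[e He].
  have : (D *m K) e j = K (src e) j - K (tgt e) j.
    rewrite mxE; under eq_bigr do rewrite mxE mulrBl.
    rewrite sumrB; congr (_ - _).
      rewrite (bigD1 (src e))//= eqxx mul1r big1 ?addr0// => k /negPf ->.
      by rewrite mul0r.
    rewrite (bigD1 (tgt e))//= eqxx mul1r big1 ?addr0// => k /negPf ->.
    by rewrite mul0r.
  rewrite DK mxE => /esym/eqP; rewrite subr_eq0 => /eqP KE.
  by move: He => /orP[] /andP[/eqP <- /eqP <-].
have constK j i i' : K i j = K i' j.
  have /connectP[s] := conn i i'; elim: s i => [i _ -> //|k s IH i /= /andP[ik ks] lst].
  by rewrite (adjK _ _ _ ik) IH.
apply/eqP/matrixP => a j; rewrite !mxE.
(* A vertex is needed to name the common value of a column of [K]; without vertices the sum is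
   empty. *)
case: (pickP (fun _ : 'I_n => true)) => [i0 _|n0].
  have -> : \sum_i q^T a i * K i j = \sum_i q i 0 * K i0 j.
    by apply: eq_bigr => i _; rewrite (constK j i i0) mxE ord1.
  by rewrite -mulr_suml q0 mul0r.
by rewrite big_pred0.
Qed.

End Laplacian.

(** * Convergence of the network under abstract controls *)

Section Network.
Context {R : realType} {n m : nat}.
Variables (D : 'M[R]_(m, n)) (Mv Ev : 'I_n -> R) (yv : 'I_m -> R).
Hypotheses (HM : forall i, 0 < Mv i) (HE : forall i, 0 < Ev i) (HY : forall e, 0 < yv e).
Variables (f : R -> 'cV[R]_m) (w aM aD : R -> 'cV[R]_n) (gw ga : 'I_n -> R -> R).
Variables (pstar z : 'cV[R]_n) (finf : 'cV[R]_m) (t0 : R) (kap C dlt : 'I_n -> R).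
(** The controls enter only through sign, growth and vanishing conditions, so that both the closed
    loop and the open loop, with zero controls, are instances. The last hypothesis places [finf] in
    the affine space that the flow never leaves. *)
Hypotheses (t0_ge0 : 0 <= t0)
  (Hf : vode_sol f (fun t => diagv yv *m D *m w t))
  (Hw : forall i, ode_sol (fun t => w t i 0) (gw i))
  (Ha : forall i, ode_sol (fun t => aM t i 0) (ga i))
  (gwE : forall t i, t0 <= t -> Mv i * gw i t =
     - (Ev i * w t i 0) - (D^T *m f t) i 0 + pstar i 0 + (aD t i 0 + aM t i 0))
  (kap_gt0 : forall i, 0 < kap i) (dlt_gt0 : forall i, 0 < dlt i)
  (ga_diss : forall t i, t0 <= t ->
     aM t i 0 * (w t i 0 + ga i t) <= - (kap i * aM t i 0 ^+ 2))
  (ga_le : forall t i, t0 <= t -> `|ga i t| <= `|w t i 0| + C i * `|aM t i 0|)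
  (aD_diss : forall t i, t0 <= t -> w t i 0 * aD t i 0 <= 0)
  (aD_bnd : forall B i, exists L, forall t, t0 <= t ->
     (forall e, `|f t e 0| <= B) -> (forall i, `|w t i 0| <= B) ->
     (forall i, `|aM t i 0| <= B) -> `|aD t i 0| <= L)
  (aD_small : forall t i, t0 <= t -> `|w t i 0| < dlt i -> aD t i 0 = 0)
  (Dfinf : D^T *m finf = pstar) (finfE : finf = f 0 + diagv yv *m D *m z).

Let J : finType := ('I_m + ('I_n + 'I_n))%type.

Let x (j : J) (t : R) : R :=
  match j with
  | inl e => (f t - finf) e 0
  | inr (inl i) => w t i 0
  | inr (inr i) => aM t i 0
  end.

Let g (j : J) (t : R) : R :=
  match j with
  | inl e => (diagv yv *m D *m w t) e 0
  | inr (inl i) => gw i t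
  | inr (inr i) => ga i t
  end.

(** With these weights the exchange terms between flows and frequencies cancel in the energy
    balance, and the coupling of [w] with [aM] collects into the left-hand side of [ga_diss]. *)
Let c (j : J) : R :=
  match j with inl e => (yv e)^-1 | inr (inl i) => Mv i | inr (inr _) => 1 end.

(** Flows are undamped, hence the weight 0; their convergence needs the separate argument of
    [flow_cvg0]. *)
Let k (j : J) : R :=
  match j with inl _ => 0 | inr (inl i) => Ev i | inr (inr i) => kap i end.

Let DTf t i : (D^T *m f t) i 0 = (D^T *m (f t - finf)) i 0 + pstar i 0.
Proof. by rewrite mulmxBr Dfinf [in RHS]mxE [X in _ + X + _]mxE subrK. Qed.

Let xg j : ode_sol (x j) (g j).
Proof.
case: j => [e|[i|i]]; [|exact: Hw|exact: Ha].
apply: eq_ode_sol (ode_solD (Hf e) (ode_sol_cst (- finf e 0))) => t _ /=.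
  by rewrite !mxE.
by rewrite addr0.
Qed.

Let diss t : t0 <= t -> \sum_j c j * (x j t * g j t) <= - \sum_j k j * x j t ^+ 2.
Proof.
move=> tt; rewrite !big_sumType/=.
have -> : \sum_(e < m) (yv e)^-1 * ((f t - finf) e 0 * (diagv yv *m D *m w t) e 0) =
   \sum_i w t i 0 * (D^T *m (f t - finf)) i 0.
  transitivity (\sum_(e < m) \sum_i (f t - finf) e 0 * (D e i * w t i 0)).
    apply: eq_bigr => e _; rewrite -mulr_sumr.
    have -> : (diagv yv *m D *m w t) e 0 = yv e * \sum_i D e i * w t i 0.
      by rewrite -mulmxA /diagv mul_diag_mx !mxE.
    by rewrite mulrCA mulKf// gt_eqF.
  rewrite exchange_big/=; apply: eq_bigr => i _; rewrite [in RHS]mxE mulr_sumr.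
  by apply: eq_bigr => e _; rewrite [_^T _ _]mxE; ring.
rewrite [X in - (X + _)]big1 ?add0r; last by move=> e _; rewrite mul0r.
rewrite -!big_split/= -sumrN; apply: ler_sum => i _.
have := aD_diss i tt; have := ga_diss i tt.
rewrite (mulrCA (Mv i)) gwE// DTf; lra.
Qed.

Let gbnd B : exists L, forall t, t0 <= t ->
  (forall j, `|x j t| <= B) -> forall j, `|g j t| <= L.
Proof.
suff /choice[L HL] : forall j, exists L, forall t, t0 <= t ->
    (forall j, `|x j t| <= B) -> `|g j t| <= L.
  exists (\sum_j `|L j|) => t tt xB j.
  rewrite (bigD1 j)//= (le_trans (HL _ _ tt xB))// (le_trans (ler_norm _))//.
  by rewrite lerDl sumr_ge0.
case=> [e|[i|i]].
- exists ((\sum_j `|(diagv yv *m D) e j|) * B) => t tt xB.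
  by apply: norm_mulmx_le => i; exact: (xB (inr (inl i))).
(* The state contains [f - finf], whereas [aD_bnd] wants a bound on [f] itself: the radius is
   enlarged by the entries of [finf]. *)
- have [L HL] := aD_bnd (`|B| + \sum_e `|finf e 0|) i.
  exists ((Mv i)^-1 * (Ev i * B + (\sum_e `|D^T i e|) * B + L + B)) => t tt xB.
  have wB : `|w t i 0| <= B := xB (inr (inl i)).
  have aB : `|aM t i 0| <= B := xB (inr (inr i)).
  have BB : B <= `|B| + \sum_e `|finf e 0|.
    by rewrite (le_trans (ler_norm _))// lerDl sumr_ge0.
  have aDL : `|aD t i 0| <= L.
    apply: HL => //.
    + move=> e; have : `|(f t - finf) e 0| <= B := xB (inl e).
      rewrite !mxE => fB; rewrite -(subrK (finf e 0) (f t e 0)).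
      rewrite (le_trans (ler_normD _ _))// lerD//.
        by rewrite (le_trans fB) ?ler_norm.
      by rewrite (bigD1 e)//= lerDl sumr_ge0.
    + by move=> i'; exact: le_trans (xB (inr (inl i'))) BB.
    + by move=> i'; exact: le_trans (xB (inr (inr i'))) BB.
  have DB := @norm_mulmx_le _ _ _ D^T (f t - finf) B (fun e => xB (inl e)) i.
  have -> : `|g (inr (inl i)) t| = (Mv i)^-1 * `|Mv i * gw i t|.
    by rewrite normrM gtr0_norm// mulKf// gt_eqF.
  rewrite ler_pM2l ?invr_gt0// gwE// DTf.
  have EB : Ev i * `|w t i 0| <= Ev i * B by rewrite ler_pM2l.
  have -> : - (Ev i * w t i 0) - ((D^T *m (f t - finf)) i 0 + pstar i 0) +
      pstar i 0 + (aD t i 0 + aM t i 0) =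
    - (Ev i * w t i 0) - (D^T *m (f t - finf)) i 0 + aD t i 0 + aM t i 0 by ring.
  apply: le_trans (ler_normD _ _) _; apply: lerD => //.
  apply: le_trans (ler_normD _ _) _; apply: lerD => //.
  apply: le_trans (ler_normB _ _) _; apply: lerD => //.
  by rewrite normrN normrM gtr0_norm.
- exists (B + `|C i| * B) => t tt xB.
  have wB : `|w t i 0| <= B := xB (inr (inl i)).
  have aB : `|aM t i 0| <= B := xB (inr (inr i)).
  apply: le_trans (ga_le i tt) _; rewrite lerD//.
apply: (@le_trans _ _ (`|C i| * `|aM t i 0|)); first by rewrite ler_wpM2r // ler_norm.
by rewrite ler_wpM2l.
Qed.

Let w_cvg0 i : w t i 0 @[t --> +oo] --> 0.
Proof.
apply: (@dissipative_cvg0 _ J x g c xg _ k t0 t0_ge0 _ gbnd diss (inr (inl i))) => //=.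
  by case=> [e|[i'|i']]//=; rewrite invr_gt0.
by case=> [e|[i'|i']]//=; exact: ltW.
Qed.

Let aM_cvg0 i : aM t i 0 @[t --> +oo] --> 0.
Proof.
apply: (@dissipative_cvg0 _ J x g c xg _ k t0 t0_ge0 _ gbnd diss (inr (inr i))) => //=.
  by case=> [e|[i'|i']]//=; rewrite invr_gt0.
by case=> [e|[i'|i']]//=; exact: ltW.
Qed.

Let aD_near0 i : \forall t \near +oo, aD t i 0 = 0.
Proof.
near=> t; apply: aD_small; first by apply: ltW; near: t; exact: near_pinfty_gt.
rewrite -normrN -sub0r; near: t.
by have /cvgrPdist_lt := w_cvg0 i; apply.
Unshelve. all: by end_near.
Qed.

(** Here [Mv i * w] is the vanishing quantity and the imbalance is the forcing, slowly varying
    because its rate is linear in [w]. Rate plus forcing is eventually [- Ev i * w + aM], which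
    tends to 0. *)
Let flow_cvg0 i : (D^T *m (f t - finf)) i 0 @[t --> +oo] --> 0.
Proof.
have xgf : vode_sol (fun t => f t - finf) (fun t => diagv yv *m D *m w t).
  move=> e; exact: (xg (inl e)).
apply: (ode_sol_forcing_cvg0 (ode_solZ (Mv i) (Hw i)) (vode_sol_mulmx D^T xgf i)).
- have := cvgM (cvg_cst (Mv i)) (w_cvg0 i).
  by rewrite mulr0; apply.
- apply: (cvg_mulmx0 D^T) => e; exact: cvg_mulmx0.
have : - Ev i * w t i 0 + aM t i 0 @[t --> +oo] --> 0.
  have := cvgD (cvgM (cvg_cst (- Ev i)) (w_cvg0 i)) (aM_cvg0 i).
  by rewrite mulr0 addr0; apply.
apply: cvg_trans; apply: near_eq_cvg; near=> t.
have tt : t0 <= t by apply: ltW; near: t; exact: near_pinfty_gt.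
rewrite gwE// DTf (_ : aD t i 0 = 0); first by ring.
by near: t; exact: aD_near0.
Unshelve. all: by end_near.
Qed.

Lemma network_cvg :
  [/\ f t @[t --> +oo] --> finf, w t @[t --> +oo] --> (0 : 'cV[R]_n),
      aM t @[t --> +oo] --> (0 : 'cV[R]_n) & aD t @[t --> +oo] --> (0 : 'cV[R]_n)].
Proof.
split; apply: cvg_coord => i j; rewrite ?mxE ord1 //; last first.
  have : (0 : R) @[t --> pinfty_nbhs R] --> (0 : R) by exact: cvg_cst.
  apply: cvg_trans; apply: near_eq_cvg; near=> t.
  by apply/esym; near: t; exact: aD_near0.
have [B BL] := laplacian_factor HY D.
have Bf t : 0 <= t -> f t - finf = B *m (D^T *m (f t - finf)).
  (* [A] kills the range of [diagv yv *m D], so [A *m f] is a conserved quantity; [finf] shares its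
     value at time 0, which selects the limit among all solutions of [D^T *m x = pstar]. *)
  move=> tt; pose A := B *m D^T - 1%:M.
  have AD : A *m (diagv yv *m D) = 0.
    by rewrite mulmxBl mul1mx -mulmxA -BL subrr.
  have Af : A *m f t = A *m f 0.
    apply/colP => e; apply/eqP; rewrite -subr_eq0 -normr_le0.
    have := ode_sol_norm_le (vode_sol_mulmx A Hf e) (lexx 0) tt (k := 0).
    rewrite mul0r; apply => r _ _.
    by rewrite mulmxA AD mul0mx mxE normr0.
  have : A *m (f t - finf) = 0.
    by rewrite mulmxBr Af -mulmxBr finfE opprD addrA subrr sub0r mulmxN mulmxA AD mul0mx oppr0.
  by rewrite mulmxBl mul1mx -mulmxA => /eqP; rewrite subr_eq0 => /eqP.
have : finf i 0 + (B *m (D^T *m (f t - finf))) i 0 @[t --> +oo] --> finf i 0.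
  have := cvgD (cvg_cst (finf i 0)) (cvg_mulmx0 B flow_cvg0 i).
  by rewrite addr0; apply.
apply: cvg_trans; apply: near_eq_cvg; near=> t.
rewrite -Bf; first by rewrite !mxE; ring.
by apply: ltW; near: t; exact: near_pinfty_gt.
Unshelve. all: by end_near.
Qed.

End Network.

(** * Sign and size of the top-layer control *)

Section DF.
Context {R : realType}.
Variables (gup glo whi wlo whi_thr wlo_thr : R).
Hypotheses (gup0 : 0 < gup) (glo0 : 0 < glo) (lo : wlo < wlo_thr) (lo0 : wlo_thr < 0)
  (hi0 : 0 < whi_thr) (hi : whi_thr < whi).
Implicit Types w v : R.

Local Notation DF := (alpha_DF_i gup glo whi wlo whi_thr wlo_thr).

Lemma alpha_DF_i_diss w v : w * DF w v <= 0.
Proof.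
rewrite /alpha_DF_i; case: ifPn => [w1|_]; last case: ifPn => [w1|_]; last by rewrite mulr0.
- by rewrite pmulr_rle0 ?(lt_trans hi0)// ge_min lexx.
- by rewrite nmulr_rle0 ?(lt_trans _ lo0)// le_max lexx.
Qed.

Lemma alpha_DF_i_small w v : `|w| < Num.min whi_thr (- wlo_thr) -> DF w v = 0.
Proof.
rewrite lt_min !ltr_norml => /andP[/andP[_ w1] /andP[w2 _]].
by rewrite /alpha_DF_i ltNge ltW//= ltNge ltW// -(opprK wlo_thr).
Qed.

(** Beyond the safe bound the gain term is negative. In the application [v] is the control that
    makes the frequency stationary, so the frequency cannot increase there. *)
Lemma alpha_DF_i_hi w v : whi < w -> DF w v <= v.
Proof.
move=> w1; have w2 := lt_trans hi w1.
rewrite /alpha_DF_i w2 ge_min; apply/orP; right; rewrite gerDr.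
by rewrite pmulr_lle0 ?invr_gt0 ?subr_gt0// pmulr_rle0// subr_le0 ltW.
Qed.

Lemma alpha_DF_i_lo w v : w < wlo -> v <= DF w v.
Proof.
move=> w1; have w2 := lt_trans w1 lo.
have w3 : w <= whi_thr by rewrite ltW// (lt_trans w2)// (lt_trans lo0).
rewrite /alpha_DF_i ltNge w3/= w2 le_max; apply/orP; right; rewrite lerDr.
by rewrite mulr_ge0 ?invr_ge0 ?subr_ge0 ?ltW// mulr_gt0// subr_gt0.
Qed.

(** The quotient is singular at the threshold, but only on the side cut off by the minimum or
    maximum with 0. On the other side it is at least -1 above and at most 1 below, as the thresholds
    lie inside the safe interval. *)
Lemma alpha_DF_i_le w v : `|DF w v| <= gup + glo + `|v|.
Proof.
have /andP[v0 v1] : - `|v| <= v <= `|v| by rewrite -ler_norml.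
have S0 : 0 <= gup + glo + `|v| by rewrite !addr_ge0// ltW.
rewrite /alpha_DF_i; case: ifPn => [w1|_]; last case: ifPn => [w1|_].
- have d0 : 0 < w - whi_thr by rewrite subr_gt0.
  have k0 : - gup <= gup * (whi - w) / (w - whi_thr).
    by rewrite ler_pdivlMr// mulNr -mulrN ler_pM2l// opprB lerD2r ltW.
  rewrite ler_norml le_min ge_min; apply/andP; split; last by rewrite S0.
  rewrite oppr_le0 S0/=; move: k0; set K := gup * _ / _ => k0.
  move: glo0 v0 k0; lra.
- have d0 : 0 < wlo_thr - w by rewrite subr_gt0.
  have k0 : glo * (wlo - w) / (wlo_thr - w) <= glo.
    by rewrite ler_pdivrMr// ler_pM2l// lerD2r ltW.
  rewrite ler_norml ge_max le_max; apply/andP; split; first by rewrite oppr_le0 S0.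
  rewrite S0/=; move: k0; set K := glo * _ / _ => k0.
  move: gup0 v1 k0; lra.
- by rewrite normr0.
Qed.

End DF.

(** * Conservation, the stability filter and invariance *)

Lemma incidence_conserves (R : realType) n m (src tgt : 'I_m -> 'I_n) (x : 'cV[R]_m) :
  \sum_i ((incidence R src tgt)^T *m x) i 0 = 0.
Proof.
under eq_bigr do rewrite mxE.
rewrite exchange_big big1// => e _; rewrite -mulr_suml.
under eq_bigr do rewrite !mxE.
rewrite sumrB -!natr_sum -!big_mkcond /= !big_pred1_eq.
by rewrite subrr mul0r.
Qed.

Lemma stab_filter_le (R : realType) (e a u : R) : 0 <= e -> `|stab_filter e a u| <= e * `|a|.
Proof.
move=> e0; have ea : 0 <= e * `|a| by rewrite mulr_ge0.
rewrite /stab_filter ler_norml le_max lexx/= ge_max ge_min lexx/= andbT.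
by rewrite ge0_cp.
Qed.

(** If [y t1] exceeded [b], let [sup S] be the last time before [t1] with [y] at most [b], attained
    by continuity. After it [y] stays above [b], so its rate is nonpositive and it cannot climb. *)
Lemma ode_sol_upper_invariant (R : realType) (y h : R -> R) (b : R) :
  ode_sol y h -> y 0 <= b -> (forall t, 0 <= t -> b < y t -> h t <= 0) ->
  forall t, 0 <= t -> y t <= b.
Proof.
move=> yh y0b hneg t1 t10; rewrite leNgt; apply/negP => bt1.
pose S := [set s | 0 <= s <= t1 /\ y s <= b].
have S0 : S 0 by rewrite /S /= lexx t10.
have supS : has_sup S by split; [exists 0 | exists t1 => s [/andP[]]].
have ub s : S s -> s <= sup S by move=> Ss; exact: sup_upper_bound.
have s0 : 0 <= sup S by exact: ub.
have st1 : sup S <= t1 by apply: ge_sup => [|s [/andP[]]//]; exists 0.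
have ysup : y (sup S) <= b.
  apply/ler_addgt0Pr => e e0.
  have /cvgrPdist_lt/(_ e e0) : y s @[s --> within `[0, t1] (nbhs (sup S))] --> y (sup S).
    have /subspace_continuousP := ode_sol_continuous yh t10.
    by apply; rewrite /= in_itv/= s0 st1.
  move=> /nbhs_ballP[/= d d0 dball].
  have [s Ss sd] := sup_adherent d0 supS; have [/andP[s_ge0 s_le] ysb] := Ss.
  have : `|y (sup S) - y s| < e.
    apply: dball; last by rewrite /= in_itv/= s_ge0.
    by rewrite /ball/= ger0_norm ?subr_ge0 ?ub// ltrBlDr addrC -ltrBlDr.
  by rewrite ltr_norml => /andP[_]; lra.
suff : y t1 - y (sup S) <= 0 * (t1 - sup S).
  by rewrite mul0r subr_le0 => /le_trans/(_ ysup); rewrite leNgt bt1.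
apply: (ode_sol_le yh) => // r sr rt1.
have r0 : 0 <= r := le_trans s0 (ltW sr).
apply: hneg => //; rewrite ltNge; apply/negP => yrb.
by move: sr; rewrite ltNge ub// /S/= r0 rt1.
Qed.

(** * The closed loop *)

Unset Implicit Arguments.

Theorem theorem4p3
  (R : realType) (n m : nat)
  (* network *)
  (src tgt : 'I_m -> 'I_n) (Hgraph : simple_connected_graph src tgt)
  (Mv Ev : 'I_n -> R) (yv : 'I_m -> R)
  (HM : forall i, 0 < Mv i) (HE : forall i, 0 < Ev i) (HY : forall e, 0 < yv e)
  (Iw Iu : {set 'I_n}) (HIwu : Iw \subset Iu)
  (* bottom layer (MPC) parameters *)
  (T tt : R) (HT : 0 < T) (Htt : 0 < tt)
  (c eps Ti : 'I_n -> R)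
  (Hc : forall i, i \in Iu -> 0 < c i) (Heps : forall i, i \in Iu -> 0 < eps i)
  (HTi : forall i, i \in Iu -> 0 < Ti i)
  (d : R) (Hd : 0 < d)
  (wlo whi : 'I_n -> R) (Hw : forall i, i \in Iw -> wlo i < whi i)
  (Delta : nat -> R) (HD0 : Delta 0%N = 0) (HDinc : forall j, Delta j < Delta j.+1)
  (HDunb : forall t, exists j, t < Delta j)
  (pf : nat -> R -> 'cV[R]_n)
  (Hpf : forall j i, pwc_on (Delta j) (Delta j + tt) (fun t => pf j t i 0))
  (* top layer (DF) parameters *)
  (gup glo whi_thr wlo_thr : 'I_n -> R)
  (Hg : forall i, i \in Iw -> 0 < gup i /\ 0 < glo i)
  (Hthr : forall i, i \in Iw ->
          wlo i < wlo_thr i /\ wlo_thr i < 0 /\ 0 < whi_thr i /\ whi_thr i < whi i)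
  (* power injection *)
  (p : R -> 'cV[R]_n)
  (Hp_pwc : forall i b, pwc_on 0 b (fun t => p t i 0))
  (Hp_const : exists (tbar : R) (pstar : 'cV[R]_n),
      0 <= tbar /\ (forall t, tbar <= t -> p t = pstar) /\ \sum_i pstar i 0 = 0)
  (HepsT : forall i, i \in Iu -> eps i * Ti i < 1)
  (* closed-loop trajectory: f, omega, alpha_MPC, and u_MPC *)
  (f : R -> 'cV[R]_m) (w aM uM : R -> 'cV[R]_n)
  (Hf : vode_sol f (fun t => diagv yv *m incidence R src tgt *m w t))
  (Hw_dyn : vode_sol (fun t => diagv Mv *m w t)
     (fun t => - (diagv Ev *m w t) - (incidence R src tgt)^T *m f t + p t
               + (alpha_DF Iw (incidence R src tgt) Ev gup glo whi wlo whi_thr wlo_thr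
                    (f t) (w t) (aM t) (p t) + aM t)))
  (HaM_u : forall i, i \in Iu ->
     ode_sol (fun t => aM t i 0)
       (fun t => - (aM t i 0 / Ti i) - w t i 0 + stab_filter (eps i) (aM t i 0) (uM t i 0)))
  (HaM_0 : forall i t, i \notin Iu -> 0 <= t -> aM t i 0 = 0)
  (HuM_hold : forall j t, Delta j <= t < Delta j.+1 -> uM t = uM (Delta j))
  (HuM_opt : forall j,
     mpc_opt Iu Iw (incidence R src tgt) (diagv Mv) (diagv Ev) (diagv yv) T (horizon T tt)
       Ti eps wlo whi c d (fun k => pf j (Delta j + k%:R * T))
       (f (Delta j)) (w (Delta j)) (aM (Delta j)) (uM (Delta j)))
  (* open-loop trajectory (alpha = 0) from the same initial state *)
  (fo : R -> 'cV[R]_m) (wo : R -> 'cV[R]_n)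
  (Hfo : vode_sol fo (fun t => diagv yv *m incidence R src tgt *m wo t))
  (Hwo : vode_sol (fun t => diagv Mv *m wo t)
     (fun t => - (diagv Ev *m wo t) - (incidence R src tgt)^T *m fo t + p t))
  (Ho0 : fo 0 = f 0 /\ wo 0 = w 0) :
  let aDF := fun t => alpha_DF Iw (incidence R src tgt) Ev gup glo whi wlo whi_thr wlo_thr
                        (f t) (w t) (aM t) (p t) in
  let alpha := fun t => aDF t + aM t in
  (* (i) frequency invariance *)
  (forall i, i \in Iw -> wlo i <= w 0 i 0 <= whi i ->
     forall t, 0 <= t -> wlo i <= w t i 0 <= whi i) /\
  (* (ii) frequency attractivity *)
  (forall i, i \in Iw -> ~ (wlo i <= w 0 i 0 <= whi i) ->
     exists t0, 0 <= t0 /\ forall t, t0 <= t -> wlo i <= w t i 0 <= whi i) /\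
  (* (iii) convergence to the open-loop equilibrium (f_inf, 0) *)
  (exists finf : 'cV[R]_m,
     fo t @[t --> +oo] --> finf /\ wo t @[t --> +oo] --> (0 : 'cV[R]_n) /\
     f t @[t --> +oo] --> finf /\ w t @[t --> +oo] --> (0 : 'cV[R]_n)) /\
  (* vanishing controls *)
  alpha t @[t --> +oo] --> (0 : 'cV[R]_n) /\
  aM t @[t --> +oo] --> (0 : 'cV[R]_n) /\
  aDF t @[t --> +oo] --> (0 : 'cV[R]_n).
Proof.
move=> aDF alpha; set D := incidence R src tgt in aDF alpha Hf Hw_dyn HuM_opt Hfo Hwo *.
have [tbar [pstar [tbar0 [pE psum]]]] := Hp_const.
have rate_sol v g : vode_sol (fun t => diagv Mv *m v t) g -> forall i,
    ode_sol (fun t => v t i 0) (fun t => (Mv i)^-1 * g t i 0).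
  move=> vg i; apply: eq_ode_sol (ode_solZ (Mv i)^-1 (vg i)) => // t _.
  by rewrite /diagv mul_diag_mx !mxE mulKf// gt_eqF.
have rhsE (v : 'cV[R]_n) (q : 'cV[R]_m) (s : 'cV[R]_n) i :
    (- (diagv Ev *m v) - D^T *m q + s) i 0 = - (Ev i * v i 0) - (D^T *m q) i 0 + s i 0.
  by rewrite /diagv mul_diag_mx !mxE.
pose gw i t := (Mv i)^-1 *
  (- (Ev i * w t i 0) - (D^T *m f t) i 0 + p t i 0 + (aDF t i 0 + aM t i 0)).
have Msol i : ode_sol (fun t => w t i 0) (gw i).
  apply: eq_ode_sol (rate_sol _ _ Hw_dyn i) => // t _.
  by rewrite /gw [X in _ * X]mxE rhsE [X in _ * (_ + X)]mxE.
pose gwo i t := (Mv i)^-1 * (- (Ev i * wo t i 0) - (D^T *m fo t) i 0 + p t i 0).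
have Mosol i : ode_sol (fun t => wo t i 0) (gwo i).
  by apply: eq_ode_sol (rate_sol _ _ Hwo i) => // t _; rewrite rhsE.
have gwE t i : tbar <= t -> Mv i * gw i t =
    - (Ev i * w t i 0) - (D^T *m f t) i 0 + pstar i 0 + (aDF t i 0 + aM t i 0).
  by move=> tge; rewrite /gw pE// mulVKf// gt_eqF.
have gwoE t i : tbar <= t -> Mv i * gwo i t =
    - (Ev i * wo t i 0) - (D^T *m fo t) i 0 + pstar i 0.
  by move=> tge; rewrite /gwo pE// mulVKf// gt_eqF.
have aDFE t i : aDF t i 0 = if i \in Iw then
    alpha_DF_i (gup i) (glo i) (whi i) (wlo i) (whi_thr i) (wlo_thr i) (w t i 0)
      (Ev i * w t i 0 + (D^T *m f t) i 0 - p t i 0 - aM t i 0) else 0.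
  by rewrite [LHS]mxE.
(* The rate of [w] at [i] is [(aDF - v) / Mv i], so [alpha_DF_i_hi] and [alpha_DF_i_lo] give its
   sign outside the bounds. The lower bound is the upper one for [- w]. *)
have inv : forall i, i \in Iw -> wlo i <= w 0 i 0 <= whi i ->
    forall t, 0 <= t -> wlo i <= w t i 0 <= whi i.
  move=> i iIw /andP[w0lo w0hi] t t0.
  have [gup0 glo0] := Hg i iIw; have [lo [lo0 [hi0 hi]]] := Hthr i iIw.
  apply/andP; split.
    rewrite -lerN2 -mulN1r.
    apply: (ode_sol_upper_invariant (ode_solZ (-1) (Msol i))) => //.
      by rewrite mulN1r lerN2.
    move=> s s0; rewrite mulN1r ltrN2 => ws.
    rewrite mulN1r oppr_le0 mulr_ge0 ?invr_ge0 ?(ltW (HM i))// aDFE iIw.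
    set v := (X in alpha_DF_i _ _ _ _ _ _ _ X).
    have := alpha_DF_i_lo (gup i) (whi i) glo0 lo lo0 hi0 v ws.
    by set a := alpha_DF_i _ _ _ _ _ _ _ _; rewrite /v; lra.
  apply: (ode_sol_upper_invariant (Msol i)) => // s s0 ws.
  rewrite pmulr_rle0 ?invr_gt0// aDFE iIw.
  set v := (X in alpha_DF_i _ _ _ _ _ _ _ X).
  have := alpha_DF_i_hi (glo i) (wlo i) (wlo_thr i) gup0 hi v ws.
  by set a := alpha_DF_i _ _ _ _ _ _ _ _; rewrite /v; lra.
(* The equilibrium flow depends only on [pstar] and the initial flow, which both trajectories share;
   hence the common limit. *)
have [z zE] : exists z, D^T *m (diagv yv *m D *m z) = pstar - D^T *m f 0.
  apply: (laplacian_solve HY Hgraph).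
  rewrite (eq_bigr (fun i => pstar i 0 - (D^T *m f 0) i 0)); last by move=> i _; rewrite !mxE.
  by rewrite sumrB psum incidence_conserves subrr.
pose finf := f 0 + diagv yv *m D *m z.
have Dfinf : D^T *m finf = pstar by rewrite mulmxDr zE addrC subrK.
have [fo_cvg wo_cvg] : fo t @[t --> +oo] --> finf /\ wo t @[t --> +oo] --> (0 : 'cV[R]_n).
  have [fo0 _] := Ho0.
  (* Two zero controls are added to give the goal the shape of [network_cvg]. *)
  suff [] : [/\ fo t @[t --> +oo] --> finf, wo t @[t --> +oo] --> (0 : 'cV[R]_n),
      (fun=> 0 : 'cV[R]_n) t @[t --> pinfty_nbhs R] --> (0 : 'cV[R]_n) &
      (fun=> 0 : 'cV[R]_n) t @[t --> pinfty_nbhs R] --> (0 : 'cV[R]_n)] by [].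
  apply: (network_cvg HM HE HY (gw := gwo) (ga := fun _ _ => 0) (pstar := pstar)
    (z := z) (kap := fun=> 1) (C := fun=> 0) (dlt := fun=> 1) tbar0) => //.
  - by move=> i; apply: eq_ode_sol (ode_sol_cst 0) => t _; rewrite ?mxE.
  - by move=> t i tge; rewrite gwoE// !mxE addr0 addr0.
  - by move=> t i _; rewrite !mxE mul0r expr0n mulr0 oppr0.
  - by move=> t i _; rewrite normr0 mul0r addr0.
  - by move=> t i _; rewrite !mxE mulr0.
  - by move=> B i; exists 0 => t *; rewrite mxE normr0.
  - by move=> t i _ _; rewrite mxE.
  - by rewrite fo0.
have [f_cvg w_cvg aM_cvg aD_cvg] : [/\ f t @[t --> +oo] --> finf,
      w t @[t --> +oo] --> (0 : 'cV[R]_n),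
      aM t @[t --> +oo] --> (0 : 'cV[R]_n) & aDF t @[t --> +oo] --> (0 : 'cV[R]_n)].
  pose ga i t := if i \in Iu then
    - (aM t i 0 / Ti i) - w t i 0 + stab_filter (eps i) (aM t i 0) (uM t i 0) else 0.
  (* The damping [(Ti i)^-1 - eps i] is positive because [eps i * Ti i < 1]. Outside [Iu] the
     control is 0 and any positive damping serves; [dlt] keeps the frequency between the
     thresholds. *)
  apply: (network_cvg HM HE HY (gw := gw) (ga := ga) (pstar := pstar) (z := z)
    (kap := fun i => if i \in Iu then (Ti i)^-1 - eps i else 1)
    (C := fun i => if i \in Iu then (Ti i)^-1 + eps i else 0)
    (dlt := fun i => if i \in Iw then Num.min (whi_thr i) (- wlo_thr i) else 1) tbar0) => //.
  - move=> i; rewrite /ga; have [iu|iu] := boolP (i \in Iu); first exact: HaM_u.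
    by apply: eq_ode_sol (ode_sol_cst 0) => t t0 //; rewrite HaM_0.
  - move=> i; case: ifPn => // iu.
    by rewrite subr_gt0 -[(Ti i)^-1]mul1r ltr_pdivlMr ?HTi ?HepsT.
  - move=> i; case: ifPn => // iw; have [lo [lo0 [hi0 hi]]] := Hthr i iw.
    by rewrite lt_min hi0 oppr_gt0.
  - move=> t i tge; rewrite /ga; case: ifPn => iu; last first.
      by rewrite HaM_0 ?(le_trans tbar0)// mul0r expr0n mulr0 oppr0.
    have := stab_filter_le (aM t i 0) (uM t i 0) (ltW (Heps i iu)).
    set s := stab_filter _ _ _; set a := aM t i 0 => sa.
    have : a * s <= eps i * a ^+ 2.
      apply: le_trans (ler_norm _) _.
      by rewrite normrM -(real_normK (num_real a)) expr2 mulrCA ler_wpM2l.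
    have -> : a * (w t i 0 + (- (a / Ti i) - w t i 0 + s)) = a * s - (Ti i)^-1 * a ^+ 2 by ring.
    by lra.
  - move=> t i tge; rewrite /ga; case: ifPn => iu; last by rewrite normr0 mul0r addr0.
    have := stab_filter_le (aM t i 0) (uM t i 0) (ltW (Heps i iu)).
    set s := stab_filter _ _ _ => sa.
    rewrite mulrDl addrA (le_trans (ler_normD _ _))// lerD//.
    rewrite (le_trans (ler_normB _ _))// [leRHS]addrC lerD2r normrN normrM mulrC.
    by rewrite gtr0_norm ?invr_gt0 ?HTi.
  - move=> t i _; rewrite aDFE; case: ifPn => [iw|_]; last by rewrite mulr0.
    by have [lo [lo0 [hi0 hi]]] := Hthr i iw; exact: alpha_DF_i_diss.
  (* The last group bounds [|v|] term by term. *)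
  - move=> B i; exists (`|gup i| + `|glo i| +
      (Ev i * B + (\sum_e `|D^T i e|) * B + `|pstar i 0| + B)).
    move=> t tge fB wB aB; have B0 : 0 <= B by rewrite (le_trans _ (wB i)).
    have DB := norm_mulmx_le D^T fB i.
    have EB : Ev i * `|w t i 0| <= Ev i * B by rewrite ler_pM2l.
    rewrite aDFE pE//; case: ifPn => [iw|_]; last first.
      by rewrite normr0 !addr_ge0// ?mulr_ge0 ?sumr_ge0// ltW.
    have [lo [lo0 [hi0 hi]]] := Hthr i iw; have [gup0 glo0] := Hg i iw.
    rewrite (le_trans (alpha_DF_i_le gup0 glo0 lo hi _ _))//.
    rewrite (gtr0_norm gup0) (gtr0_norm glo0) lerD2l.
    rewrite (le_trans (ler_normB _ _))// lerD// (le_trans (ler_normB _ _))// lerD//.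
    by rewrite (le_trans (ler_normD _ _))// lerD// normrM gtr0_norm.
  - move=> t i _; rewrite aDFE; case: ifPn => // iw; exact: alpha_DF_i_small.
split; first exact: inv.
split.
  (* Attractivity follows from convergence, since 0 is interior to the safe interval. *)
  move=> i iIw _; have [lo [lo0 [hi0 hi]]] := Hthr i iIw.
  have wi : w t i 0 @[t --> +oo] --> 0.
    have := @coord_continuous R n 1 i 0 0; rewrite /continuous_at mxE.
    exact: cvg_comp w_cvg.
  have /cvgrPdist_lt/(_ (Num.min (whi i) (- wlo i))) := wi.
  rewrite lt_min (lt_trans hi0)// oppr_gt0 (lt_trans lo)// => /(_ isT) [M [_ wM]].
  exists (`|M| + 1); split; first by rewrite addr_ge0.
  move=> t Mt; have : M < t.
    by rewrite (lt_le_trans _ Mt)// (le_lt_trans (ler_norm _))// ltrDl.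
  move=> /wM; rewrite sub0r normrN lt_min !ltr_norml opprK.
  by move=> /andP[/andP[_ w1] /andP[w2 _]]; rewrite !ltW.
split; first by exists finf.
split; last by split.
rewrite -[X in _ --> X](addr0 0).
by apply: cvgD.
Qed.
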